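(* Let $G$ be a systolic group, i.e. a group that acts properly and cocompactly by simplicial automorphisms on some systolic simplicial complex. Let $H \leq G$ be a subgroup that is finitely presented as an abstract group. Then $H$ is systolic, i.e. there exists a systolic simplicial complex on which $H$ acts properly and cocompactly by simplicial automorphisms.
   Context: A simplicial complex is flag if every finite set of vertices that are pairwise connected by edges spans a simplex. A loop of length $m$ in a simplicial complex $X$ is a simplicial embedding of an $m$-cycle into $X$ (so its $m$ vertices are pairwise distinct and consecutive ones, cyclically, are joined by edges). A diagonal of a loop is an edge of $X$ connecting two non-consecutive vertices of the loop. A simplicial complex is $m$-large if every loop of length at least four and less than $m$ has a diagonal; in particular, $6$-large means that every loop of length $4$ or $5$ has a diagonal. For $m \geq 6$, an $m$-systolic complex is a simply connected, $m$-large, flag simplicial complex (simply connected includes nonempty and connected). ''Systolic'' means $6$-systolic. A group is called systolic if it acts properly and cocompactly by simplicial automorphisms on a systolic complex. Properness and cocompactness are meant in the usual sense for simplicial actions: stabilizers of simplices are finite, and there are only finitely many orbits of simplices (so the complex is automatically locally finite). The action is not required to be faithful or free, and the group may have torsion. *)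

(* Defs.v *)
From Stdlib Require Export Relations.
From mathcomp Require Export all_boot.
From mathcomp Require Export finmap.
From mathcomp Require Export boolp classical_sets cardinality.

Set Implicit Arguments.
Unset Strict Implicit.
Unset Printing Implicit Defensive.

Local Open Scope group_scope.
Local Open Scope fset_scope.
Local Open Scope classical_set_scope.

(* The carrier is exactly the vertex set. The empty set is not a simplex.
   Nothing is assumed about cardinality, dimension or local finiteness. *)
Record simplicial_complex := SimplicialComplex {
  vertex :> choiceType;
  simplex : {pred {fset vertex}};
  simplex_neq0 : forall s, s \in simplex -> s != fset0;
  simplex_vertex : forall v : vertex, [fset v] \in simplex;
  simplex_face : forall s t : {fset vertex},
    s \in simplex -> (t `<=` s)%fset -> t != fset0 -> t \in simplex
}.
Arguments simplex : clear implicits.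

Definition edge (X : simplicial_complex) : rel X :=
  fun u v => (u != v) && ([fset u; v] \in simplex X).

Definition flag (X : simplicial_complex) : Prop :=
  forall s : {fset X}, s != fset0 ->
    {in s &, forall u v, u != v -> edge u v} -> s \in simplex X.

(* A loop is the sequence of its (pairwise distinct) vertices in cyclic order. *)
Definition is_loop (X : simplicial_complex) (c : seq X) : Prop :=
  ucycle (@edge X) c.

Definition has_diagonal (X : simplicial_complex) (c : seq X) : Prop :=
  exists u v : X, [/\ u \in c, v \in c, v != next c u, u != next c v & edge u v].

Definition large (m : nat) (X : simplicial_complex) : Prop :=
  forall c : seq X, is_loop c -> 4 <= size c < m -> has_diagonal c.

(* Edge-paths may be stationary: [fset u; u] = [fset u] is a simplex. The path
   visiting v, p_1, ..., p_k in turn is given by v and p. *)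
Definition edge_path (X : simplicial_complex) (v : X) (p : seq X) : Prop :=
  path (fun x y : X => [fset x; y] \in simplex X) v p.

(* The moves generating the equivalence of edge-paths that defines the edge-path
   group of X, i.e. its fundamental group. The vertices u, v, w need not be
   distinct, so backtracking u v u may be replaced by u u, and then by u. *)
Inductive elementary_homotopy (X : simplicial_complex) : relation (seq X) :=
| ElemStutter (p q : seq X) (u : X) :
    elementary_homotopy (p ++ [:: u, u & q]) (p ++ u :: q)
| ElemTriangle (p q : seq X) (u v w : X) : [fset u; v; w] \in simplex X ->
    elementary_homotopy (p ++ [:: u, v, w & q]) (p ++ [:: u, w & q]).

Definition path_homotopic (X : simplicial_complex) : relation (seq X) :=
  clos_refl_sym_trans (seq X) (@elementary_homotopy X).

Definition connected_complex (X : simplicial_complex) : Prop :=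
  forall u v : X, exists p : seq X, edge_path u p /\ last u p = v.

Definition simply_connected (X : simplicial_complex) : Prop :=
  [/\ exists v : X, True,
      connected_complex X
    & forall (v : X) (p : seq X), edge_path v p -> last v p = v ->
        path_homotopic (v :: p) [:: v]].

Definition m_systolic (m : nat) (X : simplicial_complex) : Prop :=
  [/\ 6 <= m, simply_connected X, large m X & flag X].

Definition systolic (X : simplicial_complex) : Prop := m_systolic 6 X.

(* By the action laws the inverse of [act g] is [act g^-1], hence simplicial too,
   so each [act g] is a simplicial automorphism. *)
Record simplicial_action (G : groupType) (X : simplicial_complex) :=
  SimplicialAction {
    act :> G -> X -> X;
    act_one : forall x, act 1 x = x;
    act_mul : forall g h x, act (g * h) x = act g (act h x);
    act_simplex : forall g (s : {fset X}),
      s \in simplex X -> [fset act g x | x in s] \in simplex X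
  }.

Section ActionOnSimplices.
Variables (G : groupType) (X : simplicial_complex) (a : simplicial_action G X).

Definition simplex_stabilizer (s : {fset X}) : set G :=
  [set g | [fset a g x | x in s] = s].

Definition simplex_orbit (s : {fset X}) : set {fset X} :=
  [set t | exists g : G, t = [fset a g x | x in s]].

Definition proper_action : Prop :=
  forall s : {fset X}, s \in simplex X -> finite_set (simplex_stabilizer s).

Definition cocompact_action : Prop :=
  finite_set [set simplex_orbit s | s in [set s | s \in simplex X]].

End ActionOnSimplices.

Definition systolic_group (G : groupType) : Prop :=
  exists X : simplicial_complex, systolic X /\
    exists a : simplicial_action G X, proper_action a /\ cocompact_action a.

(* (i, false) is the i-th generator and (i, true) its formal inverse. *)
Definition word (n : nat) := seq ('I_n * bool).

Definition word_eval (G : groupType) (n : nat) (x : 'I_n -> G) (w : word n) : G :=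
  \prod_(l <- w) (if l.2 then (x l.1)^-1 else x l.1).

Inductive relator_step (n : nat) (R : seq (word n)) : relation (word n) :=
| StepCancel (u v : word n) (i : 'I_n) (b : bool) :
    relator_step R (u ++ [:: (i, b), (i, ~~ b) & v]) (u ++ v)
| StepRelator (u v r : word n) : r \in R ->
    relator_step R (u ++ r ++ v) (u ++ v).

(* The quotient of [word n] by this relation is the group presented by < n | R >:
   inserting and deleting relators anywhere is factoring the free group by their
   normal closure. *)
Definition presentation_eq (n : nat) (R : seq (word n)) : relation (word n) :=
  clos_refl_sym_trans (word n) (relator_step R).

(* [word_eval x] induces an isomorphism from < n | R > onto G. *)
Definition is_presentation (G : groupType) (n : nat) (x : 'I_n -> G)
    (R : seq (word n)) : Prop :=
  (forall g : G, exists w : word n, word_eval x w = g) /\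
  (forall w1 w2 : word n,
     word_eval x w1 = word_eval x w2 <-> presentation_eq R w1 w2).

Definition finitely_presented (G : groupType) : Prop :=
  exists (n : nat) (x : 'I_n -> G) (R : seq (word n)), is_presentation x R.

(* Main.v *)
(** Let [H] act on the systolic complex [X].  Since [H] is finitely presented and
    [X] is simply connected, some simply connected flag complex [K] on a vertex
    set [V = H * I], with [I] finite, has finitely many [H]-orbits of edges and
    maps simplicially and equivariantly to [X]: subdivide a Cayley graph of [H]
    and attach the [H]-translates of null-homotopies in [X] of the finitely many
    relators.

    Among the [H]-invariant graphs on [V] that contain the edges of [K], map to
    [X] (so that they are locally finite), and whose 4- and 5-cycles have
    diagonals, choose a minimal one, [Q]; pulling back the 1-skeleton of [X] shows
    that there is one.  Keeping only the edges of [Q] that are homotopic in [Q] to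
    a path in [K] yields another such graph, because every diagonal of a 4- or
    5-cycle is the third side of a triangle on two edges of the cycle.  So by
    minimality every path in [Q] is homotopic to a path in [K], and [Q] is simply
    connected.  Its flag complex carries the free action of [H] on [H * I]. *)

Require Import Defs.

Set Implicit Arguments.
Unset Strict Implicit.
Unset Printing Implicit Defensive.

Local Open Scope group_scope.
Local Open Scope fset_scope.
Local Open Scope classical_set_scope.

(** * Edge-path homotopy in graphs *)

Section Homotopy.
Variable T : eqType.
Implicit Types (e : rel T) (x y u v : T) (p q s t : seq T).

Inductive move e : relation (seq T) :=
| MoveStutter p q u : move e (p ++ [:: u, u & q]) (p ++ u :: q)
| MoveTriangle p q u v w : e u v -> e v w -> e u w ->
    move e (p ++ [:: u, v, w & q]) (p ++ [:: u, w & q]).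

Definition homotopic e : relation (seq T) := clos_refl_sym_trans _ (move e).

Lemma hom_refl e s : homotopic e s s. Proof. exact: rst_refl. Qed.
Lemma hom_sym e s t : homotopic e s t -> homotopic e t s.
Proof. exact: rst_sym. Qed.
Lemma hom_trans e s t r : homotopic e s t -> homotopic e t r -> homotopic e s r.
Proof. exact: rst_trans. Qed.

Lemma hom_ctx e p q s t :
  homotopic e s t -> homotopic e (p ++ s ++ q) (p ++ t ++ q).
Proof.
elim=> {s t} [s t [] | | |].
- move=> p' q' u; apply: rst_step.
  by have := MoveStutter e (p ++ p') (q' ++ q) u; rewrite -!catA.
- move=> p' q' u v w uv vw uw; apply: rst_step.
  by have := MoveTriangle (p ++ p') (q' ++ q) uv vw uw; rewrite -!catA.
- by move=> s; apply: hom_refl.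
- by move=> s t _ /hom_sym.
- by move=> s t r _ + _; apply: hom_trans.
Qed.

Lemma hom_catl e x p q q' : homotopic e (last x p :: q) (last x p :: q') ->
  homotopic e (x :: p ++ q) (x :: p ++ q').
Proof.
move=> /(hom_ctx (belast x p) [::]); rewrite !cats0 -!cat_rcons -lastI.
by [].
Qed.

Lemma hom_catr e x p p' q : homotopic e (x :: p) (x :: p') ->
  homotopic e (x :: p ++ q) (x :: p' ++ q).
Proof. exact: (@hom_ctx e [::] q). Qed.

Lemma hom_stutter e u : homotopic e [:: u; u] [:: u].
Proof. exact/rst_step/(MoveStutter e [::] [::]). Qed.

Lemma hom_triangle e u v w : e u v -> e v w -> e u w ->
  homotopic e [:: u; v; w] [:: u; w].
Proof. by move=> *; apply/rst_step/(@MoveTriangle e [::] [::]). Qed.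

Lemma hom_sub e e' s t : subrel e e' -> homotopic e s t -> homotopic e' s t.
Proof.
move=> ee'; elim=> {s t} [s t [] | | |].
- by move=> p q u; apply/rst_step/MoveStutter.
- by move=> p q u v w /ee' uv /ee' vw /ee' uw; apply/rst_step/MoveTriangle.
- by move=> s; apply: hom_refl.
- by move=> s t _ /hom_sym.
- by move=> s t r _ + _; apply: hom_trans.
Qed.

Lemma hom_rev e s t :
  symmetric e -> homotopic e s t -> homotopic e (rev s) (rev t).
Proof.
move=> eC; elim=> {s t} [s t [] | | |].
- move=> p q u; rewrite !rev_cat !rev_cons -!cats1 -!catA.
  exact/rst_step/MoveStutter.
- move=> p q u v w uv vw uw; rewrite !rev_cat !rev_cons -!cats1 -!catA.
  by apply/rst_step/MoveTriangle; rewrite eC.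
- by move=> s; apply: hom_refl.
- by move=> s t _ /hom_sym.
- by move=> s t r _ + _; apply: hom_trans.
Qed.

Lemma rev_belast x p : rev (x :: p) = last x p :: rev (belast x p).
Proof. by rewrite lastI rev_rcons. Qed.

Lemma last_rev_belast x p : last (last x p) (rev (belast x p)) = x.
Proof.
have := rev_belast x p; rewrite rev_cons lastI.
by move/(congr1 (last x)); rewrite -lastI last_rcons /= => <-.
Qed.

Lemma path_rev e x p : symmetric e ->
  path e (last x p) (rev (belast x p)) = path e x p.
Proof. by move=> eC; rewrite rev_path; apply: eq_path => u v; rewrite eC. Qed.

(** Contracted from the turning point outwards: the remaining spur [x a x] is a degenerate triangle
    with third side [x x], filled by reflexivity. *)
Lemma hom_backtrack e x p : reflexive e -> symmetric e -> path e x p ->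
  homotopic e (x :: p ++ rev (belast x p)) [:: x].
Proof.
move=> eR eC; elim: p x => [|a p IHp] x /=; first by move=> _; apply: hom_refl.
case/andP=> xa /IHp ap; rewrite rev_cons -cats1.
have := hom_ctx [:: x] [:: x] ap; rewrite /= -catA => h.
apply: hom_trans h _; apply: hom_trans (hom_stutter e x).
by apply: hom_triangle => //; rewrite eC.
Qed.

Lemma hom_backtrack_rev e x p : reflexive e -> symmetric e -> path e x p ->
  homotopic e (last x p :: rev (belast x p) ++ p) [:: last x p].
Proof.
move=> eR eC xp.
have := @hom_backtrack e (last x p) (rev (belast x p)) eR eC.
rewrite path_rev // => /(_ xp).
suff -> : rev (belast (last x p) (rev (belast x p))) = p by [].
have := rev_belast x p; rewrite rev_cons lastI.
by move/rcons_inj => [<- _]; rewrite revK.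
Qed.

Definition simply_connected_rel e :=
  forall v p, path e v p -> last v p = v -> homotopic e (v :: p) [:: v].

(* The vertices need not be distinct: for a reflexive relation the degenerate
   cases hold automatically. *)
Definition large_rel e :=
  (forall a b c d, e a b -> e b c -> e c d -> e d a -> e a c || e b d) /\
  (forall a b c d f, e a b -> e b c -> e c d -> e d f -> e f a ->
     [|| e a c, e b d, e c f, e d a | e f b]).

End Homotopy.

Lemma hom_map (T T' : eqType) (e : rel T) (e' : rel T') (f : T -> T') s t :
  (forall u v, e u v -> e' (f u) (f v)) ->
  homotopic e s t -> homotopic e' (map f s) (map f t).
Proof.
move=> fe; elim=> {s t} [s t [] | | |].
- by move=> p q u; rewrite !map_cat; apply/rst_step/MoveStutter.
- move=> p q u v w /fe uv /fe vw /fe uw; rewrite !map_cat.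
  exact/rst_step/MoveTriangle.
- by move=> s; apply: hom_refl.
- by move=> s t _ /hom_sym.
- by move=> s t r _ + _; apply: hom_trans.
Qed.

Lemma path_map_sub (T T' : eqType) (e : rel T) (e' : rel T') (f : T -> T') x p :
  (forall u v, e u v -> e' (f u) (f v)) ->
  path e x p -> path e' (f x) (map f p).
Proof. by move=> fe; rewrite path_map; apply: sub_path => u v /fe. Qed.

(** * Minimal invariant graphs *)

Definition shift (H : groupType) (J : Type) (g : H) (u : H * J) : H * J :=
  (g * u.1, u.2).

Definition invariant_rel (H : groupType) (J : Type) (e : rel (H * J)) :=
  forall g u v, e u v -> e (shift g u) (shift g v).

Lemma shift1 (H : groupType) (J : Type) (u : H * J) : shift 1 u = u.
Proof. by case: u => h j; rewrite /shift mul1g. Qed.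

Lemma shiftM (H : groupType) (J : Type) (g h : H) (u : H * J) :
  shift (g * h) u = shift g (shift h u).
Proof. by rewrite /shift /= mulgA. Qed.

Lemma count_lt (T : eqType) (a b : pred T) (s : seq T) x :
  subpred a b -> x \in s -> b x -> ~~ a x -> (count a s < count b s)%N.
Proof.
move=> ab; elim: s => //= y s IHs; rewrite inE => /predU1P [<- | xs] bx ax.
  by rewrite bx (negPf ax) ltnS sub_count.
rewrite -addnS leq_add ?IHs //.
by case ay: (a y) => //; rewrite (ab _ ay).
Qed.

Section Core.
Variables (H : groupType) (I : finType).
Let V := (H * I)%type.
Variable R : rel V.
Hypotheses (Rsym : symmetric R) (Rinv : invariant_rel R).
Hypothesis Rsc : simply_connected_rel R.
Hypothesis Rconn : forall u v, exists2 p, path R u p & last u p = v.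

(* The full subgraph spanned by [V] in the universal cover of the flag complex
   of [Q], into which the simply connected complex of [R] lifts. *)
Definition core (Q : rel V) : rel V := fun u v =>
  `[< Q u v /\ exists p, [/\ path R u p, last u p = v &
        homotopic Q (u :: p) [:: u; v]] >].

Lemma core_sub Q : subrel (core Q) Q.
Proof. by move=> u v /asboolP []. Qed.

Lemma sub_core Q : reflexive Q -> subrel R Q -> subrel R (core Q).
Proof.
move=> Qr RQ u v uv; apply/asboolP; split; first exact: RQ.
by exists [:: v]; split=> //=; [rewrite uv | apply: hom_refl].
Qed.

Lemma core_refl Q : reflexive Q -> reflexive (core Q).
Proof.
move=> Qr u; apply/asboolP; split=> //; exists [::]; split=> //.
exact/hom_sym/hom_stutter.
Qed.

Lemma core_sym Q : symmetric Q -> symmetric (core Q).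
Proof.
move=> Qs; suff h u v : core Q u v -> core Q v u.
  by move=> u v; apply/idP/idP; apply: h.
case/asboolP=> uv [p [pp pv hp]]; apply/asboolP; split; first by rewrite Qs.
exists (rev (belast u p)); rewrite -pv path_rev // last_rev_belast; split=> //.
by rewrite -rev_belast pv; apply: (hom_rev Qs hp).
Qed.

Lemma core_inv Q : invariant_rel Q -> invariant_rel (core Q).
Proof.
move=> Qi g u v /asboolP [uv [p [pp pv hp]]]; apply/asboolP.
split; first exact: Qi.
exists (map (shift g) p); split.
- by apply: path_map_sub pp => x y; apply: Rinv.
- by rewrite last_map pv.
- exact: (hom_map (Qi g) hp).
Qed.

(** The two [R]-paths concatenate to one homotopic to [a b c], which the triangle of [Q] shortens to
    the edge [a c]. *)
Lemma core_trans Q a b c : core Q a b -> core Q b c -> Q a c -> core Q a c.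
Proof.
case/asboolP=> ab [p [pp pb hp]] /asboolP [bc [q [qq qc hq]]] ac.
apply/asboolP; split=> //; exists (p ++ q); split.
- by rewrite cat_path pp pb.
- by rewrite last_cat pb.
apply: hom_trans (hom_catr q hp) _ => /=.
apply: hom_trans (@hom_catl _ Q a [:: b] q [:: c] hq) _.
exact: hom_triangle.
Qed.

(** Each diagonal offered by [Q] cuts off a triangle with two sides on the cycle, so [core_trans]
    puts it in the core. *)
Lemma core_large Q : symmetric Q -> large_rel Q -> large_rel (core Q).
Proof.
move=> Qs [L4 L5].
have cs := core_sym Qs; have sb := @core_sub Q.
have tr x y z : core Q x y -> core Q y z -> Q x z -> core Q x z.
  exact: core_trans.
split=> [a b c d ab bc cd da | a b c d f ab bc cd df fa].
  have := L4 _ _ _ _ (sb _ _ ab) (sb _ _ bc) (sb _ _ cd) (sb _ _ da).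
  by case/orP=> h; [rewrite (tr a b c) | rewrite (tr b c d) ?orbT].
have := L5 _ _ _ _ _ (sb _ _ ab) (sb _ _ bc) (sb _ _ cd) (sb _ _ df) (sb _ _ fa).
case/or4P => [h|h|h|/orP [h|h]].
- by rewrite (tr a b c).
- by rewrite (tr b c d) ?orbT.
- by rewrite (tr c d f) ?orbT.
- by rewrite (tr d f a) ?orbT.
- by rewrite (tr f a b) ?orbT.
Qed.

(** Replacing each edge of a [Q]-loop by a homotopic [R]-path gives an [R]-loop, which contracts
    already in [R]. *)
Lemma core_fixed_sc Q : subrel R Q -> subrel Q (core Q) ->
  simply_connected_rel Q.
Proof.
move=> RQ Qc v p vp pv.
have: exists q, [/\ path R v q, last v q = last v p
                  & homotopic Q (v :: q) (v :: p)].
  elim: p v vp {pv} => [|a p IHp] v /=.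
    by exists [::]; split=> //; apply: hom_refl.
  case/andP=> /Qc /asboolP [va [s [ss sa hs]]] /IHp [q [qq qp hq]].
  exists (s ++ q); split.
  - by rewrite cat_path ss sa.
  - by rewrite last_cat sa.
  apply: hom_trans (hom_catr q hs) _.
  exact: (@hom_catl _ Q v [:: a] q p hq).
case=> q [qq qp hq]; apply: hom_trans (hom_sym hq) _.
by apply: (hom_sub RQ); apply: Rsc; rewrite // qp.
Qed.

(** Repeated passage to the core must stop: an invariant subrelation of [Q0] is determined by its
    edges out of the finitely many [(1, i)], and these end in [N]. *)
Theorem exists_simply_connected_large (Q0 : rel V) (N : seq V) :
  reflexive Q0 -> symmetric Q0 -> invariant_rel Q0 -> large_rel Q0 ->
  (forall i v, Q0 (1, i) v -> v \in N) -> subrel R Q0 ->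
  exists Q : rel V, [/\ [/\ reflexive Q, symmetric Q & invariant_rel Q],
    large_rel Q, simply_connected_rel Q, subrel Q Q0 & subrel R Q].
Proof.
move=> Q0r Q0s Q0i Q0l Q0N RQ0.
(* [N2] contains every edge of [Q0] issuing from some [(1, i)]; [m], counting those in [Q], is the
   induction measure. *)
pose N2 := [seq ((1 : H, i), v) | i <- enum I, v <- N].
pose m (Q : rel V) := count (fun p => Q p.1 p.2) N2.
suff: forall k Q, (m Q < k)%N -> reflexive Q -> symmetric Q -> invariant_rel Q ->
    large_rel Q -> subrel R Q -> subrel Q Q0 ->
  exists Q' : rel V, [/\ [/\ reflexive Q', symmetric Q' & invariant_rel Q'],
    large_rel Q', simply_connected_rel Q', subrel Q' Q0 & subrel R Q'].
  by move=> /(_ (m Q0).+1 Q0); apply.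
elim=> // k IHk Q mQ Qr Qs Qi Ql RQ QQ0.
have [Qc | /existsNP [u /existsNP [v /not_implyP [uv /negP ncuv]]]] :=
  pselect (subrel Q (core Q)).
  by exists Q; split=> //; apply: core_fixed_sc.
apply: (IHk (core Q)); last first.
- by move=> x y /core_sub /QQ0.
- exact: sub_core.
- exact: core_large.
- exact: core_inv.
- exact: core_sym.
- exact: core_refl.
rewrite -ltnS; apply: leq_trans mQ; rewrite ltnS.
(* The edge missing from the core is translated to start at [(1, u.2)], so that it occurs in [N2]
   and the measure drops. *)
have Quv := Qi u.1^-1 _ _ uv.
have e1 : shift u.1^-1 u = (1, u.2) by rewrite /shift mulVg.
apply: (@count_lt _ _ _ _ ((1, u.2), shift u.1^-1 v)).
- by move=> x; apply: core_sub.
- apply: allpairs_f; first by rewrite mem_enum.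
  by apply/(Q0N u.2)/QQ0; rewrite -e1.
- by rewrite /= -e1.
- apply: contra ncuv => /=; rewrite -e1 => /(core_inv Qi u.1).
  by rewrite -!shiftM mulgV !shift1.
Qed.

End Core.

(** * Flag complexes and graphs *)

Section AdjacencyOfComplex.
Variable X : simplicial_complex.

Definition adj : rel X := fun u v => [fset u; v] \in simplex X.

Lemma adj_refl : reflexive adj.
Proof. by move=> u; rewrite /adj fsetUid simplex_vertex. Qed.

Lemma adj_sym : symmetric adj.
Proof. by move=> u v; rewrite /adj fsetUC. Qed.

Lemma adj_simplex (s : {fset X}) u v :
  s \in simplex X -> u \in s -> v \in s -> adj u v.
Proof.
move=> sX us vs; apply: (simplex_face sX).
  by apply/fsubsetP => w; rewrite !inE => /orP [] /eqP ->.
by apply/fset0Pn; exists u; rewrite !inE eqxx.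
Qed.

Lemma edgeE u v : edge u v = (u != v) && adj u v. Proof. by []. Qed.

(** If two vertices coincide, a diagonal comes from reflexivity or from a side of the cycle;
    otherwise the vertices form a loop of [X]. *)
Lemma adj_large : large 6 X -> large_rel adj.
Proof.
move=> lX; split=> [a b c d ab bc cd da | a b c d f ab bc cd df fa].
  have [/eqP e|nab] := boolP (a == b); first by subst; rewrite (adj_sym _ d) da orbT.
  have [/eqP e|nbc] := boolP (b == c); first by subst; rewrite ab.
  have [/eqP e|ncd] := boolP (c == d); first by subst; rewrite bc orbT.
  have [/eqP e|nda] := boolP (d == a); first by subst; rewrite (adj_sym _ c) cd.
  have [/eqP e|nac] := boolP (a == c); first by subst; rewrite adj_refl.
  have [/eqP e|nbd] := boolP (b == d); first by subst; rewrite adj_refl orbT.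
  have nad := nda; rewrite eq_sym in nad.
  have nba := nab; rewrite eq_sym in nba.
  have nca := nac; rewrite eq_sym in nca.
  have ncb := nbc; rewrite eq_sym in ncb.
  have ndb := nbd; rewrite eq_sym in ndb.
  have ndc := ncd; rewrite eq_sym in ndc.
  have lc : is_loop [:: a; b; c; d].
    rewrite /is_loop /ucycle /= !edgeE ab bc cd da nab nbc ncd nda /=.
    by rewrite !inE !negb_or nab nbc ncd nac nbd nad.
  have [u [v []]] := lX _ lc isT.
  rewrite !inE edgeE => hu hv; move: hu hv.
  (* All positions of [u] and [v] on the loop are tried: equal or consecutive ones are excluded, the
     others give the required diagonals. *)
  by do 2!(case/or4P => /eqP ->); rewrite /= ?eqxx ?(negPf nab) ?(negPf nba)
   ?(negPf nac) ?(negPf nca) ?(negPf nad) ?(negPf nda) ?(negPf nbc) ?(negPf ncb)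
   ?(negPf nbd) ?(negPf ndb) ?(negPf ncd) ?(negPf ndc) ?eqxx // => _ _ /andP [_];
   rewrite ?(adj_sym c a) ?(adj_sym d b) => ->; rewrite ?orbT.
have [/eqP e|nab] := boolP (a == b); first by subst; rewrite fa !orbT.
have [/eqP e|nbc] := boolP (b == c); first by subst; rewrite ab.
have [/eqP e|ncd] := boolP (c == d); first by subst; rewrite bc orbT.
have [/eqP e|ndf] := boolP (d == f); first by subst; rewrite cd !orbT.
have [/eqP e|nfa] := boolP (f == a); first by subst; rewrite df !orbT.
have [/eqP e|nac] := boolP (a == c); first by subst; rewrite adj_refl.
have [/eqP e|nbd] := boolP (b == d); first by subst; rewrite adj_refl !orbT.
have [/eqP e|ncf] := boolP (c == f); first by subst; rewrite adj_refl !orbT.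
have [/eqP e|nda] := boolP (d == a); first by subst; rewrite adj_refl !orbT.
have [/eqP e|nfb] := boolP (f == b); first by subst; rewrite adj_refl !orbT.
have nba := nab; rewrite eq_sym in nba.
have ncb := nbc; rewrite eq_sym in ncb.
have ndc := ncd; rewrite eq_sym in ndc.
have nfd := ndf; rewrite eq_sym in nfd.
have naf := nfa; rewrite eq_sym in naf.
have nca := nac; rewrite eq_sym in nca.
have ndb := nbd; rewrite eq_sym in ndb.
have nfc := ncf; rewrite eq_sym in nfc.
have nad := nda; rewrite eq_sym in nad.
have nbf := nfb; rewrite eq_sym in nbf.
have lc : is_loop [:: a; b; c; d; f].
  rewrite /is_loop /ucycle /= !edgeE ab bc cd df fa nab nbc ncd ndf nfa /=.
  by rewrite !inE !negb_or nab nbc ncd nac nbd nad naf nbf ncf ndf.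
have [u [v []]] := lX _ lc isT.
rewrite !inE edgeE => hu hv; move: hu hv.
by do 2!(case/or4P => [||| /orP []] /eqP ->); rewrite /= ?eqxx ?(negPf nab)
   ?(negPf nba) ?(negPf nbc) ?(negPf ncb) ?(negPf ncd) ?(negPf ndc) ?(negPf ndf)
   ?(negPf nfd) ?(negPf nfa) ?(negPf naf) ?(negPf nac) ?(negPf nca) ?(negPf nbd)
   ?(negPf ndb) ?(negPf ncf) ?(negPf nfc) ?(negPf nda) ?(negPf nad) ?(negPf nfb)
   ?(negPf nbf) ?eqxx // => _ _ /andP [_];
   rewrite ?(adj_sym c a) ?(adj_sym d b) ?(adj_sym f c) ?(adj_sym a d)
     ?(adj_sym b f) => ->; rewrite ?orbT.
Qed.

End AdjacencyOfComplex.

Section CliqueComplex.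
Variables (T : choiceType) (e : rel T).
Hypotheses (er : reflexive e) (es : symmetric e).

Definition clique : {pred {fset T}} :=
  fun s => (s != fset0) && all2rel e s.

Lemma cliqueP (s : {fset T}) :
  reflect (s != fset0 /\ {in s &, forall u v, e u v}) (s \in clique).
Proof. by apply: (iffP andP) => -[s0 /allrelP]. Qed.

Lemma clique_neq0 s : s \in clique -> s != fset0.
Proof. by case/cliqueP. Qed.

Lemma clique_vertex v : [fset v] \in clique.
Proof.
apply/cliqueP; split; first by apply/fset0Pn; exists v; rewrite inE.
by move=> x y; rewrite !inE => /eqP -> /eqP ->.
Qed.

Lemma clique_face (s t : {fset T}) :
  s \in clique -> (t `<=` s)%fset -> t != fset0 -> t \in clique.
Proof.
case/cliqueP=> _ se /fsubsetP ts t0; apply/cliqueP; split=> //.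
by move=> u v /ts us /ts vs; apply: se.
Qed.

Definition clique_complex :=
  @SimplicialComplex T clique clique_neq0 clique_vertex clique_face.

Lemma clique_adj : @adj clique_complex =2 e.
Proof.
move=> u v; apply/cliqueP/idP => [[_]|uv].
  by apply; rewrite !inE eqxx ?orbT.
split=> [|x y]; first by apply/fset0Pn; exists u; rewrite !inE eqxx.
by rewrite !inE => /orP [] /eqP -> /orP [] /eqP ->; rewrite // es.
Qed.

Lemma clique_triangle u v w : e u v -> e v w -> e u w ->
  [fset u; v; w] \in clique.
Proof.
move=> uv vw uw; apply/cliqueP; split.
  by apply/fset0Pn; exists u; rewrite !inE eqxx.
move=> x y; rewrite !inE -!orbA.
by case/or3P => /eqP -> /or3P [] /eqP ->; rewrite // es.
Qed.

Lemma clique_flag : flag clique_complex.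
Proof.
move=> s s0 se; apply/cliqueP; split=> // u v us vs.
have [-> //|uv] := eqVneq u v.
by have /andP [_] := se _ _ us vs uv; rewrite -clique_adj.
Qed.

Lemma clique_homotopic s t :
  homotopic e s t -> @path_homotopic clique_complex s t.
Proof.
elim=> {s t} [s t [] | s | s t _ | s t r _ + _].
- by move=> p q u; apply/rst_step/ElemStutter.
- move=> p q u v w uv vw uw; apply/rst_step.
  exact/(@ElemTriangle clique_complex)/clique_triangle.
- exact: rst_refl.
- exact: rst_sym.
- exact: rst_trans.
Qed.

Lemma clique_large : large_rel e -> large 6 clique_complex.
Proof.
move=> [L4 L5] c /andP [cc uc] /andP [].
have edgeP u v : edge (X := clique_complex) u v = (u != v) && e u v.
  by rewrite edgeE clique_adj.
case: c cc uc => [|a [|b [|c [|d [|f [|]]]]]] //=;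
  rewrite !edgeP !inE !negb_or.
- case/and5P => /andP [_ ab] /andP [_ bc] /andP [_ cd] /andP [nda da] _.
  case/and4P=> /and3P [nab nac nad] /andP [nbc nbd] ncd _ _ _.
  have nba := nab; rewrite eq_sym in nba.
  have nca := nac; rewrite eq_sym in nca.
  have ncb := nbc; rewrite eq_sym in ncb.
  have ndb := nbd; rewrite eq_sym in ndb.
  have ndc := ncd; rewrite eq_sym in ndc.
  case/orP: (L4 _ _ _ _ ab bc cd da) => h.
    exists a, c; split; rewrite ?edgeP ?nac ?h // ?inE ?eqxx ?orbT //=
      ?(negPf nca) ?(negPf ncb) ?eqxx //.
  by exists b, d; split; rewrite ?edgeP ?nbd ?h // ?inE ?eqxx ?orbT //=
      ?(negPf nba) ?(negPf nda) ?(negPf ndb) ?(negPf ndc) ?eqxx.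
case/and5P => /andP [_ ab] /andP [_ bc] /andP [_ cd] /andP [_ df].
case/andP => /andP [nfa fa] _.
case/and5P=> /and4P [nab nac nad naf] /and3P [nbc nbd nbf] /andP [ncd ncf] ndf _ _ _.
have nba := nab; rewrite eq_sym in nba.
have ncb := nbc; rewrite eq_sym in ncb.
have ndc := ncd; rewrite eq_sym in ndc.
have nfd := ndf; rewrite eq_sym in nfd.
have nca := nac; rewrite eq_sym in nca.
have ndb := nbd; rewrite eq_sym in ndb.
have nfc := ncf; rewrite eq_sym in nfc.
have nda := nad; rewrite eq_sym in nda.
have nfb := nbf; rewrite eq_sym in nfb.
have diag u v : u \in [:: a; b; c; d; f] -> v \in [:: a; b; c; d; f] ->
    [&& u != v, v != next [:: a; b; c; d; f] u & u != next [:: a; b; c; d; f] v] ->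
    e u v -> has_diagonal (X := clique_complex) [:: a; b; c; d; f].
  by move=> hu hv /and3P [uv h1 h2] uve; exists u, v; split; rewrite ?edgeP ?uv.
case/or4P: (L5 _ _ _ _ _ ab bc cd df fa) => [||| /orP []];
  apply: diag; rewrite ?inE ?eqxx ?orbT //= ?eqxx
   ?(negPf nab)
   ?(negPf nba) ?(negPf nbc) ?(negPf ncb) ?(negPf ncd) ?(negPf ndc) ?(negPf ndf)
   ?(negPf nfd) ?(negPf nfa) ?(negPf naf) ?(negPf nac) ?(negPf nca) ?(negPf nbd)
   ?(negPf ndb) ?(negPf ncf) ?(negPf nfc) ?(negPf nda) ?(negPf nad) ?(negPf nfb)
   ?(negPf nbf) //= ?nfd ?nca ?naf ?nba //.
Qed.

Lemma clique_systolic (v0 : T) : large_rel e -> simply_connected_rel e ->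
  (forall u v, exists2 p, path e u p & last u p = v) -> systolic clique_complex.
Proof.
move=> el esc ec; split=> //; last exact: clique_flag; last exact: clique_large.
have pe v p : edge_path (X := clique_complex) v p <-> path e v p.
  by rewrite -(eq_path clique_adj).
split; first by exists v0.
  by move=> u v; have [p /pe pp pv] := ec u v; exists p.
by move=> v p /pe vp pv; apply/clique_homotopic/esc.
Qed.

End CliqueComplex.

(** * Free actions on clique complexes *)

Section FreeAction.
Variables (H : groupType) (I : finType).
Let V := (H * I)%type.
Variable e : rel V.
Hypotheses (er : reflexive e) (es : symmetric e) (ei : invariant_rel e).

Let Y := clique_complex er.

Lemma clique_shift g (s : {fset Y}) : s \in simplex Y ->
  [fset shift g x | x in s] \in simplex Y.
Proof.
case/cliqueP => /fset0Pn [x xs] se; apply/cliqueP; split.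
  by apply/fset0Pn; exists (shift g x); apply: in_imfset.
by move=> _ _ /imfsetP [u us ->] /imfsetP [v vs ->]; apply/ei/se.
Qed.

Lemma clique_shift_shift g k (s : {fset Y}) :
  [fset shift g x | x in [fset shift k x | x in s]] =
  [fset shift (g * k) x | x in s] :> {fset Y}.
Proof.
apply/fsetP => y; apply/imfsetP/imfsetP => [[_ /imfsetP [x xs ->] ->]|[x xs ->]].
  by exists x; rewrite ?shiftM.
by exists (shift k x); rewrite ?shiftM ?in_imfset.
Qed.

Definition clique_action : simplicial_action H Y :=
  @SimplicialAction H Y (@shift H I) (@shift1 H I) (@shiftM H I) clique_shift.

(** A stabilizing element sends the chosen vertex [x] to some [y] in [s], and the [H]-coordinates
    force it to be [y.1 * x.1^-1]. *)
Lemma clique_action_proper : proper_action clique_action.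
Proof.
move=> s /cliqueP [/fset0Pn [x xs] _].
apply: (sub_finite_set
  (B := [set g | g \in [seq y.1 * x.1^-1 | y : V <- s]])); last exact: finite_seq.
move=> g /= gs; apply/mapP; exists (shift g x); last by rewrite /= mulgK.
by rewrite -gs; apply/imfsetP; exists x.
Qed.

(** A clique translated so that one vertex has [H]-coordinate 1 lies in [N], so the finitely many
    subsets of [N] represent all orbits. *)
Lemma clique_action_cocompact (N : seq V) :
  (forall i v, e (1, i) v -> v \in N) -> cocompact_action clique_action.
Proof.
move=> eN; pose F := [fset x in (N : seq Y)].
apply: (sub_finite_set (B := [set simplex_orbit clique_action s |
   s in [set` fpowerset F]])); last exact/finite_image/finite_fset.
move=> _ [s /= sY <-]; have [/fset0Pn [x xs] se] := cliqueP _ _ sY.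
exists [fset shift x.1^-1 y | y in s].
  rewrite /= fpowersetE; apply/fsubsetP => _ /imfsetP [y ys ->].
  rewrite !inE; apply: (eN x.2).
  have := ei x.1^-1 (se _ _ xs ys).
  by rewrite {1}/shift mulVg.
apply/seteqP; split=> [t [g ->]|t [g ->]].
  by exists (g * x.1^-1); rewrite clique_shift_shift.
exists (g * x.1); rewrite clique_shift_shift; apply/fsetP => y.
by rewrite mulgK.
Qed.

Theorem systolic_group_of_rel (N : seq V) (v0 : V) :
  (forall i v, e (1, i) v -> v \in N) -> large_rel e ->
  simply_connected_rel e ->
  (forall u v, exists2 p, path e u p & last u p = v) -> systolic_group H.
Proof.
move=> eN el esc ec; exists Y; split; first exact: (clique_systolic _ es v0).
exists clique_action; split; first exact: clique_action_proper.
exact: clique_action_cocompact eN.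
Qed.

End FreeAction.

(** * Graphs developed over a Cayley graph *)

Section Span.
Variables (H : groupType) (J : choiceType) (j0 : J).
Let U := (H * J)%type.
Implicit Types (E : seq (U * U)) (u v a b : U).

Definition origin (h : H) : U := (h, j0).

Lemma shift_origin g h : shift g (origin h) = origin (g * h). Proof. by []. Qed.

(** The least reflexive, symmetric, invariant relation containing [E] ([span_min]); a finite list
    thus encodes finitely many orbits of edges. *)
Definition span E : rel U := fun u v => (u == v) ||
  `[< exists g a b, [/\ ((a, b) \in E) || ((b, a) \in E),
                        u = shift g a & v = shift g b] >].

Lemma span_refl E : reflexive (span E).
Proof. by move=> u; rewrite /span eqxx. Qed.

Lemma span_gen E a b : (a, b) \in E -> span E a b.
Proof.
move=> abE; apply/orP; right; apply/asboolP; exists 1, a, b.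
by rewrite abE !shift1.
Qed.

Lemma span_sym E : symmetric (span E).
Proof.
suff h u v : span E u v -> span E v u by move=> u v; apply/idP/idP; apply: h.
case/orP => [/eqP ->|/asboolP [g [a [b [abE -> ->]]]]]; first exact: span_refl.
by apply/orP; right; apply/asboolP; exists g, b, a; rewrite orbC.
Qed.

Lemma span_inv E : invariant_rel (span E).
Proof.
move=> k u v /orP [/eqP ->|/asboolP [g [a [b [abE -> ->]]]]].
  exact: span_refl.
by apply/orP; right; apply/asboolP; exists (k * g), a, b; rewrite !shiftM.
Qed.

Lemma span_min E (e : rel U) : reflexive e -> symmetric e -> invariant_rel e ->
  (forall a b, (a, b) \in E -> e a b) -> subrel (span E) e.
Proof.
move=> er es ei Ee u v /orP [/eqP -> //|/asboolP [g [a [b [abE -> ->]]]]].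
by apply: ei; case/orP: abE => /Ee //; rewrite es.
Qed.

Lemma span_sub E E' : {subset E <= E'} -> subrel (span E) (span E').
Proof.
move=> EE'; apply: span_min.
- exact: span_refl.
- exact: span_sym.
- exact: span_inv.
- by move=> a b /EE'; apply: span_gen.
Qed.

(** Labels of the vertex orbits in use; [j0] labels the vertices of the Cayley graph and is always
    included. *)
Definition dom E : seq J := j0 :: flatten [seq [:: e.1.2; e.2.2] | e <- E].

Lemma domP E j : reflect (j = j0 \/ exists2 e, e \in E & j = e.1.2 \/ j = e.2.2)
  (j \in dom E).
Proof.
rewrite inE; apply: (iffP predU1P) => -[->|]; try by left.
  case/flatten_mapP => e eE; rewrite !inE => je; right; exists e => //.
  by case/orP: je => /eqP ->; [left|right].
case=> e eE je; right; apply/flatten_mapP; exists e => //; rewrite !inE.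
by case: je => ->; rewrite eqxx ?orbT.
Qed.

Lemma dom0 E : j0 \in dom E. Proof. by rewrite inE eqxx. Qed.

Lemma span_dom E u v : span E u v -> (u.2 \in dom E) = (v.2 \in dom E).
Proof.
case/orP => [/eqP -> //|/asboolP [g [a [b [abE -> ->]]]]] /=.
have [ad bd] : a.2 \in dom E /\ b.2 \in dom E; last by rewrite ad bd.
have d2 c d : (c, d) \in E -> c.2 \in dom E /\ d.2 \in dom E.
  by move=> cdE; split; apply/domP; right; exists (c, d) => //=; auto.
by case/orP: abE => /d2 [].
Qed.

Lemma path_dom E u p : path (span E) u p ->
  (u.2 \in dom E) = ((last u p).2 \in dom E).
Proof. by elim: p u => //= v p IHp u /andP [/span_dom -> /IHp]. Qed.

Lemma dom_sub E E' : {subset E <= E'} -> {subset dom E <= dom E'}.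
Proof.
move=> EE' j /domP [->|[e /EE' eE je]]; apply/domP; first by left.
by right; exists e.
Qed.

Lemma dom_cons E a b j : j \in dom ((a, b) :: E) ->
  [\/ j = a.2, j = b.2 | j \in dom E].
Proof.
case/domP => [->|[e]]; first by constructor 3; apply: dom0.
rewrite inE => /predU1P [->|eE] je; first by case: je; [constructor 1|constructor 2].
by constructor 3; apply/domP; right; exists e.
Qed.

Section Development.
Variables (n : nat) (x : 'I_n -> H).
Variable pth : 'I_n * bool -> seq U.
Notation ev := (word_eval x).

(** The subdivided Cayley path of a word, without its start: [pth l] stands for the edge of the
    letter [l] at the identity and is translated to the element reached so far. *)
Fixpoint word_path (h : H) (w : word n) : seq U :=
  if w is l :: w' then map (shift h) (pth l) ++ word_path (h * ev [:: l]) w'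
  else [::].

Lemma word_eval_cat w1 w2 : ev (w1 ++ w2) = ev w1 * ev w2.
Proof. by rewrite /word_eval big_cat. Qed.

Lemma word_eval_nil : ev [::] = 1.
Proof. by rewrite /word_eval big_nil. Qed.

Lemma word_path_cat h w1 w2 :
  word_path h (w1 ++ w2) = word_path h w1 ++ word_path (h * ev w1) w2.
Proof.
elim: w1 h => [|l w1 IHw] h /=; first by rewrite word_eval_nil mulg1.
by rewrite IHw -catA -mulgA -word_eval_cat.
Qed.

Lemma word_path_shift g h w :
  map (shift g) (word_path h w) = word_path (g * h) w.
Proof.
elim: w h => //= l w IHw h; rewrite map_cat IHw mulgA -map_comp.
by congr (_ ++ _); apply: eq_map => u; rewrite /= shiftM.
Qed.

Definition letter_ends := forall l, last (origin 1) (pth l) = origin (ev [:: l]).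

Definition letter_paths E := forall l, path (span E) (origin 1) (pth l).

Lemma last_shift g u p : last (shift g u) (map (shift g) p) = shift g (last u p).
Proof. by rewrite last_map. Qed.

Lemma last_origin h p :
  last (origin h) (map (shift h) p) = shift h (last (origin 1) p).
Proof. by rewrite -{1}[h]mulg1 -shift_origin last_shift. Qed.

Lemma path_origin E h p :
  path (span E) (origin 1) p -> path (span E) (origin h) (map (shift h) p).
Proof.
move=> /(path_map_sub (f := shift h) (@span_inv E h)).
by rewrite shift_origin mulg1.
Qed.

Lemma hom_origin E h p q : homotopic (span E) (origin 1 :: p) (origin 1 :: q) ->
  homotopic (span E) (origin h :: map (shift h) p) (origin h :: map (shift h) q).
Proof.
by move/(hom_map (f := shift h) (@span_inv E h)); rewrite /= shift_origin mulg1.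
Qed.

Lemma last_word_path h w : letter_ends ->
  last (origin h) (word_path h w) = origin (h * ev w).
Proof.
move=> pe; elim: w h => [|l w IHw] h /=; first by rewrite word_eval_nil mulg1.
rewrite last_cat last_origin pe shift_origin IHw.
by rewrite -mulgA -word_eval_cat.
Qed.

Lemma word_path_path E h w : letter_ends -> letter_paths E ->
  path (span E) (origin h) (word_path h w).
Proof.
move=> pe pp; elim: w h => //= l w IHw h.
by rewrite cat_path path_origin // last_origin pe shift_origin IHw.
Qed.

(* [c j] is a path from the origin to [(1, j)] and plays the role of a spanning
   tree: up to homotopy every edge is a loop of the Cayley graph. *)
Definition linked E (c : J -> seq U) u v := exists w, v.1 = u.1 * ev w /\
  homotopic (span E) (origin u.1 :: map (shift u.1) (c u.2) ++ [:: v])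
    (origin u.1 :: word_path u.1 w ++ map (shift v.1) (c v.2)).

Definition tree_paths E (c : J -> seq U) := c j0 = [::] /\
  forall j, j \in dom E ->
    path (span E) (origin 1) (c j) /\ last (origin 1) (c j) = (1, j).

(** The invariant kept while edges are attached. It reduces every path, up to tree paths at its
    ends, to a word path, so that only relators remain to be contracted. *)
Definition developed E c := tree_paths E c /\
  forall a b, (a, b) \in E -> linked E c a b /\ linked E c b a.

Lemma linked_shift E c g u v : linked E c u v -> linked E c (shift g u) (shift g v).
Proof.
case=> w [vw hw]; exists w; split; first by rewrite /= vw mulgA.
have := hom_map (f := shift g) (@span_inv E g) hw.
rewrite /= !map_cat /= -!map_comp word_path_shift.
by rewrite -!(eq_map (shiftM _ _)).
Qed.

Lemma linked_mono E E' c c' u v : {subset E <= E'} -> c u.2 = c' u.2 ->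
  c v.2 = c' v.2 -> linked E c u v -> linked E' c' u v.
Proof.
move=> EE' cu cv [w [vw hw]]; exists w; split=> //; rewrite -cu -cv.
exact: hom_sub (span_sub EE') hw.
Qed.

Lemma tree_path E c u : tree_paths E c -> u.2 \in dom E ->
  path (span E) (origin u.1) (map (shift u.1) (c u.2)) /\
  last (origin u.1) (map (shift u.1) (c u.2)) = u.
Proof.
move=> [_ tc] /tc [cp cl]; split; first exact: path_origin.
by rewrite last_origin cl /shift mulg1; case: u {cp cl}.
Qed.

Lemma linked_refl E c u : tree_paths E c -> u.2 \in dom E -> linked E c u u.
Proof.
move=> tc /(tree_path tc) [_ cl].
exists [::]; split; first by rewrite word_eval_nil mulg1.
rewrite /= -{2}[map _ _]cats0.
by apply: hom_catl; rewrite cl; apply: hom_stutter.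
Qed.

Lemma developed_linked E c u v : developed E c -> u.2 \in dom E ->
  span E u v -> linked E c u v.
Proof.
move=> [tc dE] ud /orP [/eqP <-|/asboolP [g [a [b [abE -> ->]]]]].
  exact: linked_refl.
by apply: linked_shift; case/orP: abE => /dE [].
Qed.

(** The edge [a b] may be replaced by the path [a v b], along which the words of the two edges
    concatenate. *)
Lemma linked_trans E c a v b : letter_ends -> tree_paths E c -> a.2 \in dom E ->
  v.2 \in dom E ->
  span E a v -> span E v b -> span E a b ->
  linked E c a v -> linked E c v b -> linked E c a b.
Proof.
move=> pe tc ad vd av vb ab [w1 [e1 h1]] [w2 [e2 h2]]; exists (w1 ++ w2).
split; first by rewrite e2 e1 word_eval_cat mulgA.
have [_ cl] := tree_path tc ad.
apply: (@hom_trans _ _ _ (origin a.1 :: map (shift a.1) (c a.2) ++ [:: v; b])).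
  by apply: hom_catl; rewrite cl; apply/hom_sym/hom_triangle.
have := hom_catr [:: b] h1; rewrite -!catA; move/hom_trans; apply.
rewrite word_path_cat -catA; apply: hom_catl.
by rewrite last_word_path // -e1.
Qed.

(** The new vertex is a leaf at [(1, i)]: its tree path prolongs [c i] by the new edge, which the
    empty word therefore links in both directions. *)
Lemma developed_vertex E c i j : developed E c -> i \in dom E -> j \notin dom E ->
  developed (((1, i), (1, j)) :: E)
    (fun k => if k == j then rcons (c i) (1, j) else c k).
Proof.
set E' := _ :: E; set c' := fun k => _; case=> tc dE iE jE.
have EE' : {subset E <= E'} by move=> e eE; rewrite inE eE orbT.
have c'E k : k \in dom E -> c' k = c k.
  by rewrite /c'; case: eqP => // -> jd; rewrite jd in jE.
have [ci li] := tc.2 _ iE.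
have c'j : c' j = c i ++ [:: (1, j)] by rewrite /c' eqxx cats1.
have ij : span E' (1, i) (1, j) by apply: span_gen; rewrite inE eqxx.
have t' : tree_paths E' c'.
  split; first by rewrite c'E ?dom0 // tc.1.
  move=> k kE; have [kd|kd] := boolP (k \in dom E).
    rewrite c'E //; have [ck lk] := tc.2 _ kd; split=> //.
    by apply: (sub_path (span_sub EE')) ck.
  case: (dom_cons kE) => [ki|->|kd']; [by rewrite ki iE in kd| |by rewrite kd' in kd].
  rewrite c'j cat_path last_cat li /= ij !andbT; split=> //.
  by apply: (sub_path (span_sub EE')) ci.
split=> // a b; rewrite inE => /predU1P [[-> ->]|abE].
  have h1 : map (@shift H J 1) =1 id.
    by move=> s; rewrite (eq_map (@shift1 _ _)) map_id.
  split; exists [::]; rewrite word_eval_nil mulg1; split=> //=;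
    rewrite !h1 c'j c'E //; first exact: hom_refl.
  (* From the leaf to [(1, i)] the path runs over the new edge and back, a degenerate triangle. *)
  rewrite -catA -[X in homotopic _ _ (_ :: X)]cats0; apply: hom_catl; rewrite li.
  apply: hom_trans (hom_stutter _ _); apply: hom_triangle => //.
    by rewrite span_sym.
  exact: span_refl.
have dab k : k = a.2 \/ k = b.2 -> k \in dom E.
  by move=> kab; apply/domP; right; exists (a, b).
have [l1 l2] := dE _ _ abE.
by split; [apply: linked_mono l1|apply: linked_mono l2];
   rewrite ?c'E //; apply: dab; auto.
Qed.

Lemma developed_edge E c a b : developed E c -> a.2 \in dom E -> b.2 \in dom E ->
  linked ((a, b) :: E) c a b -> linked ((a, b) :: E) c b a ->
  developed ((a, b) :: E) c.
Proof.
set E' := _ :: E; move=> [tc dE] ad bd lab lba.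
have EE' : {subset E <= E'} by move=> e eE; rewrite inE eE orbT.
split.
  split; first exact: tc.1.
  move=> k /dom_cons kE; have kd : k \in dom E by case: kE => [->|->|].
  have [ck lk] := tc.2 _ kd; split=> //.
  by apply: (sub_path (span_sub EE')) ck.
move=> a' b'; rewrite inE => /predU1P [[-> ->] //|abE].
have [l1 l2] := dE _ _ abE.
by split; [apply: linked_mono l1|apply: linked_mono l2].
Qed.

(** The new edge closes a triangle on two edges already present, so [linked_trans] through [v] links
    it in both directions. *)
Lemma developed_triangle E c a v b : letter_ends -> developed E c ->
  a.2 \in dom E -> span E a v -> span E v b -> developed ((a, b) :: E) c.
Proof.
move=> pe dE ad av vb; have vd : v.2 \in dom E by rewrite -(span_dom av).
have bd : b.2 \in dom E by rewrite -(span_dom vb).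
set E' := _ :: E.
have EE' : {subset E <= E'} by move=> e eE; rewrite inE eE orbT.
have t' : tree_paths E' c.
  split; first exact: dE.1.1.
  move=> k /dom_cons kE; have kd : k \in dom E by case: kE => [->|->|].
  have [ck lk] := dE.1.2 _ kd; split=> //.
  by apply: (sub_path (span_sub EE')) ck.
have ab : span E' a b by apply: span_gen; rewrite inE eqxx.
have sE := span_sub EE'; have dd := dom_sub EE'.
have lk u w : u.2 \in dom E -> span E u w -> linked E' c u w.
  by move=> ud uw; apply: (linked_mono EE') => //; apply: developed_linked.
have [va bv] : span E v a /\ span E b v by split; rewrite span_sym.
apply: developed_edge => //.
  exact: (linked_trans pe t' (dd _ ad) (dd _ vd) (sE _ _ av) (sE _ _ vb) ab
            (lk _ _ ad av) (lk _ _ vd vb)).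
apply: (linked_trans pe t' (dd _ bd) (dd _ vd) (sE _ _ bv) (sE _ _ va) _
            (lk _ _ bd bv) (lk _ _ vd va)).
by rewrite span_sym.
Qed.

End Development.
End Span.

(** * Filling relators in a simply connected complex *)

Lemma fresh_index (T : choiceType) (s : seq (T * nat)) (y : T) :
  exists k, (y, k) \notin s.
Proof.
exists (\max_(p <- s) p.2).+1; apply/negP => ys.
by have := @leq_bigmax_seq _ s predT snd _ ys isT; rewrite ltnn.
Qed.

(** * The equivariant map to the complex, trees and letter paths *)

Section Placement.
Variables (H : groupType) (X : simplicial_complex) (act : simplicial_action H X).
Variable x0 : X.
(* The natural number keeps apart vertices with the same image in [X]. *)
Local Notation J := (X * nat)%type.
Local Notation U := (H * J)%type.
Local Notation j0 := ((x0, 0%N) : J).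

(** This map is equivariant ([place_shift]); [placed E] makes it simplicial on [span E]
    ([span_adj]). *)
Definition place (u : U) : X := act u.1 u.2.1.

Lemma place_shift g u : place (shift g u) = act g (place u).
Proof. exact: act_mul. Qed.

Lemma place1 j : place (1, j) = j.1. Proof. exact: act_one. Qed.

Lemma adj_act g u v : adj u v -> adj (act g u) (act g v).
Proof.
move=> uv; have := act_simplex act g uv; congr (_ \in simplex X).
apply/fsetP => w; rewrite !inE; apply/imfsetP/orP => [[z]|].
  by rewrite !inE => /orP [] /eqP -> ->; rewrite eqxx; auto.
by case=> /eqP ->; [exists u|exists v]; rewrite // !inE eqxx ?orbT.
Qed.

Definition placed (E : seq (U * U)) :=
  forall a b, (a, b) \in E -> adj (place a) (place b).

Lemma placed_cons E a b :
  adj (place a) (place b) -> placed E -> placed ((a, b) :: E).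
Proof. by move=> ab pE c d; rewrite inE => /predU1P [[-> ->]|/pE]. Qed.

Lemma span_adj E u v : placed E -> span E u v -> adj (place u) (place v).
Proof.
move=> pE; apply: (span_min (e := fun u v => adj (place u) (place v))).
- by move=> w; apply: adj_refl.
- by move=> w t; apply: adj_sym.
- by move=> g w t; rewrite !place_shift; apply: adj_act.
- exact: pE.
Qed.

Section Tree.
Variables (n : nat) (x : 'I_n -> H).

(** Each vertex of [p] gets a fresh index and is attached as a leaf. All [pth] are allowed because
    letter paths are chosen only after the tree is built. *)
Lemma tree_extend (p : seq X) (z : X) k E c :
  (forall pth, developed j0 x pth E c) -> placed E -> (z, k) \in dom j0 E ->
  path (@adj X) z p ->
  exists E' c', [/\ forall pth, developed j0 x pth E' c', placed E',
    {subset E <= E'} & exists k', (last z p, k') \in dom j0 E'].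
Proof.
elim: p z k E c => [|y p IHp] z k E c dE pE zk /=.
  by move=> _; exists E, c; split=> //; exists k.
case/andP=> zy yp; have [m ym] := fresh_index (dom j0 E) y.
have dE' pth := developed_vertex (dE pth) zk ym.
set E' := _ :: E in dE'.
have ymE : (y, m) \in dom j0 E'.
  apply/domP; right; exists ((1, (z, k)), (1, (y, m))); last by right.
  by rewrite inE eqxx.
have [|E'' [c'' [d'' p'' s'' l'']]] := IHp y m _ _ dE' _ ymE yp.
  by apply: placed_cons; rewrite // !place1.
exists E'', c''; split=> // e eE; apply: s''.
by rewrite inE eE orbT.
Qed.

Lemma tree_exists (ys : seq X) : connected_complex X ->
  exists E c, [/\ forall pth, developed j0 x pth E c, placed E &
    {in ys, forall y, exists k, (y, k) \in dom j0 E}].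
Proof.
move=> cX; elim: ys => [|y ys [E [c [dE pE yE]]]].
  exists [::], (fun=> [::]); split=> // pth; split=> //.
  by split=> // j /domP [->|[e]].
have [p [xp py]] := cX x0 y.
have [E' [c' [dE' pE' EE' [k kE']]]] := tree_extend dE pE (dom0 _ _) xp.
exists E', c'; split=> // z; rewrite inE => /predU1P [->|/yE [m mE]].
  by exists k; rewrite -py.
by exists m; apply: (dom_sub EE').
Qed.

Lemma word_eval1 l : word_eval x [:: l] = if l.2 then (x l.1)^-1 else x l.1.
Proof. by rewrite /word_eval big_seq1. Qed.

(** The tree is grown until it contains, for each generator, a vertex over the image of [x0] under
    it; one further edge joins that vertex to the Cayley vertex of the generator. *)
Lemma letters_exist : connected_complex X ->
  exists pth E c, [/\ letter_ends j0 x pth, letter_paths j0 pth E,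
    developed j0 x pth E c & placed E].
Proof.
move=> cX.
have [E [c [dE pE yE]]] := tree_exists [seq act (x i) x0 | i <- enum 'I_n] cX.
have /fin_all_exists [k kE] : forall i, exists k, (act (x i) x0, k) \in dom j0 E.
  by move=> i; apply/yE/map_f; rewrite mem_enum.
pose jj i : J := (act (x i) x0, k i).
pose o : U := origin j0 1.
pose fwd i := rcons (c (jj i)) (origin j0 (x i)).
(* An inverse letter runs backwards along the generator's path, translated so as to start at [o]. *)
pose pth (l : 'I_n * bool) :=
  if l.2 then map (shift (x l.1)^-1) (rev (belast o (fwd l.1))) else fwd l.1.
pose E' := [seq ((1, jj i), origin j0 (x i)) | i <- enum 'I_n] ++ E.
have EE' : {subset E <= E'} by move=> e eE; rewrite mem_cat eE orbT.
have [[c0 tc] _] := dE pth.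
have newE i : ((1, jj i), origin j0 (x i)) \in E'.
  by rewrite mem_cat; apply/orP; left; apply/mapP; exists i; rewrite ?mem_enum.
have fwd_path i : path (span E') o (fwd i).
  have [cp cl] := tc _ (kE i).
  rewrite rcons_path cl span_gen ?newE // andbT.
  exact: (sub_path (span_sub EE')) cp.
have fwd_last i : last o (fwd i) = origin j0 (x i) by rewrite last_rcons.
have dom' j : j \in dom j0 E' -> j \in dom j0 E.
  case/domP => [->|[e]]; first exact: dom0.
  rewrite mem_cat => /orP [/mapP [i _ ->] /= [->|->]|eE je].
  - exact: kE.
  - exact: dom0.
  - by apply/domP; right; exists e.
have oV i : o = shift (x i)^-1 (origin j0 (x i)) by rewrite shift_origin mulVg.
have s1 (s : seq U) : map (shift 1) s = s.
  by rewrite (eq_map (@shift1 _ _)) map_id.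
exists pth, E', c; split.
- case=> i [] /=; rewrite word_eval1 /pth /=; last exact: fwd_last.
  by rewrite -/o {1}(oV i) -(fwd_last i) last_shift last_rev_belast /shift mulg1.
- case=> i []; rewrite /pth /=; last exact: fwd_path.
  rewrite -/o {1}(oV i) -(fwd_last i).
  apply: (path_map_sub (f := shift (x i)^-1) (@span_inv _ _ E' _)).
  by rewrite path_rev ?fwd_path //; apply: span_sym.
- have [_ dl] := dE pth; split.
    split=> // j /dom' /tc [cp cl]; split=> //.
    exact: (sub_path (span_sub EE')) cp.
  move=> a b; rewrite mem_cat => /orP [/mapP [i _ [-> ->]]|abE]; last first.
    have [l1 l2] := dl _ _ abE.
    by split; [apply: linked_mono l1|apply: linked_mono l2].
  have [cp cl] := tc _ (kE i).
  split; [exists [:: (i, false)]|exists [:: (i, true)]]; split=> /=;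
    rewrite ?word_eval1 ?mul1g ?mulgV //= c0 /= ?cats0 !s1 /pth /=.
    by rewrite /fwd cats1; apply: hom_refl.
  (* The inverse letter runs back along the tree path to [o], and the tree path then returns: this
     backtracking cancels. *)
  rewrite -map_comp (@eq_map _ _ _ id) ?map_id; last first.
    by move=> u; rewrite /= -shiftM mulgV shift1.
  rewrite /fwd belast_rcons rev_belast cl.
  have cp' := sub_path (span_sub EE') cp.
  have := hom_backtrack_rev (@span_refl _ _ _) (@span_sym _ _ _) cp'.
  by move/hom_sym/(hom_ctx [:: origin j0 (x i)] [::]); rewrite !cats0 cl.
- move=> a b; rewrite mem_cat => /orP [/mapP [i _ [-> ->]]|/pE //].
  (* Both ends of the new edge lie over [act (x i) x0]. *)
  by rewrite place1 /place /= adj_refl.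
Qed.

End Tree.
End Placement.

Lemma map_eq_cat (T T' : Type) (f : T -> T') s p q : map f s = p ++ q ->
  exists s1 s2, [/\ s = s1 ++ s2, map f s1 = p & map f s2 = q].
Proof.
move=> e; exists (take (size p) s), (drop (size p) s).
by rewrite cat_take_drop map_take map_drop e take_size_cat ?drop_size_cat.
Qed.

Section TriangleMoves.
Variable X : simplicial_complex.

(* Moves between the paths that start at a fixed vertex [z] not in the list: a
   stationary step is then the degenerate triangle on it and its predecessor. *)
Inductive triangle_move (z : X) : relation (seq X) :=
| TriangleMove p q v w : adj (last z p) v -> adj v w -> adj (last z p) w ->
    triangle_move z (p ++ [:: v, w & q]) (p ++ w :: q).

Lemma triangle_move_path z s t :
  triangle_move z s t -> path (@adj X) z s = path (@adj X) z t.
Proof. by case=> p q v w pv vw pw; rewrite !cat_path /= pv vw pw. Qed.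

(** For a stutter, the path hypothesis supplies the adjacency of [u] to its predecessor that a
    triangle move requires. *)
Lemma elementary_triangle_move z s t : elementary_homotopy s t ->
  path (@adj X) z s || path (@adj X) z t -> triangle_move z s t.
Proof.
case=> [p q u|p q u v w uvw _].
  rewrite !cat_path /= => h; have pu : adj (last z p) u.
    by case/orP: h => /and3P [].
  by apply: TriangleMove; rewrite ?adj_refl.
have [hu hv hw] : [/\ u \in [fset u; v; w], v \in [fset u; v; w] &
                   w \in [fset u; v; w]].
  by rewrite !inE !eqxx ?orbT.
rewrite -!(cat_rcons u); apply: TriangleMove; rewrite ?last_rcons;
  exact: (adj_simplex uvw).
Qed.

(** Elementary homotopies do not ask for paths, but each one preserves and reflects being a path
    from [z]; the induction carries both facts. *)
Lemma path_homotopic_triangle z s t : path_homotopic s t ->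
  path (@adj X) z s = path (@adj X) z t /\
  (path (@adj X) z s -> clos_refl_sym_trans _ (triangle_move z) s t).
Proof.
elim=> {s t} [s t st | s | s t _ [e h] | s t r _ [e1 h1] _ [e2 h2]].
- have h := elementary_triangle_move (z := z) st; split.
    by apply/idP/idP => st'; have := h; rewrite st' ?orbT => /(_ isT)
      /triangle_move_path; rewrite st'.
  by move=> sp; apply/rst_step/h; rewrite sp.
- by split=> // _; apply: rst_refl.
- by split=> // tp; apply/rst_sym/h; rewrite e.
- split; first by rewrite e1.
  by move=> sp; apply: rst_trans (h1 sp) (h2 _); rewrite -e1.
Qed.

End TriangleMoves.

Section Filling.
Variables (H : groupType) (X : simplicial_complex) (act : simplicial_action H X).
Variable x0 : X.
Local Notation J := (X * nat)%type.
Local Notation U := (H * J)%type.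
Local Notation j0 := ((x0, 0%N) : J).
Variables (n : nat) (x : 'I_n -> H) (pth : 'I_n * bool -> seq U).
Hypothesis pth_ends : letter_ends j0 x pth.
Local Notation o := (origin j0 1 : U).

Lemma lift_move E c P s t : developed j0 x pth E c -> placed act E ->
  path (span E) o P -> map (place act) P = s ->
  triangle_move x0 s t \/ triangle_move x0 t s ->
  exists E' c' P', [/\ {subset E <= E'} /\ placed act E', developed j0 x pth E' c',
    path (span E') o P', map (place act) P' = t /\ last o P' = last o P &
    homotopic (span E') (o :: P) (o :: P')].
Proof.
move=> dE pE oP.
have po : place act o = x0 by rewrite place1.
move=> Ps; case=> st; case: st Ps => p q v w pv vw pw.
- case/map_eq_cat=> [P0 [[|b [|d Q]] [eP Pp]]] //= [bv dw Qq].
  move: oP; rewrite eP cat_path /=; set a := last o P0.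
  case/and4P=> oP0 ab bd dQ.
  have ad : a.2 \in dom j0 E by rewrite -(path_dom _ oP0) dom0.
  have pa : place act a = last x0 p by rewrite /a -(last_map (place act)) po Pp.
  have dE' := developed_triangle pth_ends dE ad ab bd.
  set E' := _ :: E in dE'.
  have EE' : {subset E <= E'} by move=> e eE; rewrite inE eE orbT.
  have ad' : span E' a d by apply: span_gen; rewrite inE eqxx.
  have sE := span_sub EE'.
  exists E', c, (P0 ++ d :: Q); split=> //.
  + by split=> //; apply: placed_cons; rewrite // pa dw.
  + by rewrite cat_path /= -/a ad' (sub_path sE oP0) (sub_path sE dQ).
  + by rewrite map_cat /= Pp dw Qq !last_cat.
  + apply: hom_catl; rewrite -/a.
    apply: (@hom_ctx _ _ [::] Q [:: a; b; d] [:: a; d]).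
    by apply: hom_triangle => //; apply: sE.
case/map_eq_cat=> [P0 [[|d Q] [eP Pp]]] //= [dw Qq].
move: oP; rewrite eP cat_path /=; set a := last o P0.
case/and3P=> oP0 ad dQ.
have da : a.2 \in dom j0 E by rewrite -(path_dom _ oP0) dom0.
have pa : place act a = last x0 p by rewrite /a -(last_map (place act)) po Pp.
have [k fr] := fresh_index (dom j0 E) (act a.1^-1 v).
have dE1 := developed_vertex dE da fr.
set E1 := _ :: E in dE1; set c1 := fun _ => _ in dE1.
(* A leaf shares the [H]-coordinate of its neighbour [a], so its label must be [act a.1^-1 v] for it
   to lie over [v]. *)
pose b : U := (a.1, (act a.1^-1 v, k)).
have pb : place act b = v by rewrite /place /= -act_mul mulgV act_one.
have EE1 : {subset E <= E1} by move=> e eE; rewrite inE eE orbT.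
have ab : span E1 a b.
  have := @span_gen _ _ E1 (1, a.2) (1, b.2).
  rewrite inE eqxx => /(_ isT) /(@span_inv _ _ _ a.1).
  have -> : shift a.1 (1, a.2) = a by rewrite /shift mulg1 -surjective_pairing.
  by rewrite /shift mulg1.
have dE2 : developed j0 x pth ((b, d) :: E1) c1.
  apply: (developed_triangle pth_ends dE1 (v := a)).
  - by rewrite -(span_dom _ ab) (dom_sub EE1).
  - by rewrite span_sym.
  - exact: span_sub EE1 _ _ ad.
set E2 := _ :: E1 in dE2.
have E12 : {subset E1 <= E2} by move=> e eE; rewrite inE eE orbT.
have bd : span E2 b d by apply: span_gen; rewrite inE eqxx.
have EE2 : {subset E <= E2} by move=> e /EE1 /E12.
have ab2 := span_sub E12 ab; have ad2 := span_sub EE2 ad.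
have sE := span_sub EE2.
exists E2, c1, (P0 ++ [:: b, d & Q]); split=> //.
- split=> //; apply: placed_cons; first by rewrite pb dw.
  apply: placed_cons pE; rewrite !place1 /=.
  have := adj_act act a.1^-1 pv.
  rewrite -pa /place -act_mul mulVg act_one; exact.
- by rewrite cat_path /= -/a ab2 bd (sub_path sE oP0) (sub_path sE dQ).
- by rewrite map_cat /= Pp pb dw Qq !last_cat.
- apply: hom_catl; rewrite -/a; apply: hom_sym.
  apply: (@hom_ctx _ _ [::] Q [:: a; b; d] [:: a; d]).
  exact: hom_triangle.
Qed.

Lemma lift_moves s t : clos_refl_sym_trans _ (triangle_move x0) s t ->
  forall E c P, developed j0 x pth E c -> placed act E ->
  path (span E) o P -> map (place act) P = s ->
  exists E' c' P', [/\ {subset E <= E'} /\ placed act E', developed j0 x pth E' c',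
    path (span E') o P', map (place act) P' = t /\ last o P' = last o P &
    homotopic (span E') (o :: P) (o :: P')].
Proof.
move=> st; have {st} := clos_rst_rst1n _ _ _ _ st.
elim=> {s t} [s|s r t sr _ IH] E c P dE pE oP Ps.
  by exists E, c, P; do ?split=> //; apply: hom_refl.
have [E1 [c1 [P1 [[EE1 pE1] dE1 oP1 [mP1 lP1] h1]]]] := lift_move dE pE oP Ps sr.
have [E2 [c2 [P2 [[EE2 pE2] dE2 oP2 [mP2 lP2] h2]]]] := IH _ _ _ dE1 pE1 oP1 mP1.
exists E2, c2, P2; split=> //.
- by split=> // e /EE1 /EE2.
- by split=> //; rewrite lP2.
- exact: hom_trans (hom_sub (span_sub EE2) h1) h2.
Qed.

(** A relator's word path is a loop whose image contracts in [X]; lifting that contraction move by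
    move attaches the edges that contract the loop upstairs. *)
Lemma fill_relators (R : seq (word n)) E c : simply_connected X ->
  developed j0 x pth E c -> placed act E -> letter_paths j0 pth E ->
  {in R, forall r, word_eval x r = 1} ->
  exists E' c', [/\ {subset E <= E'}, placed act E', developed j0 x pth E' c' &
    {in R, forall r, homotopic (span E') (o :: word_path x pth 1 r) [:: o]}].
Proof.
move=> [_ _ scX] + + +; elim: R E c => [|r R IHR] E c dE pE pthE R1.
  by exists E, c; split.
(* The base vertex is doubled: triangle moves act after the start, whereas the contraction in [X]
   acts on the whole list. *)
have oW : path (span E) o (o :: word_path x pth 1 r).
  by rewrite /= span_refl word_path_path.
have lW : last o (word_path x pth 1 r) = o.
  by rewrite last_word_path // R1 ?inE ?eqxx // mulg1.
have po : place act o = x0 by rewrite place1.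
have pW := path_map_sub (fun u v => @span_adj _ _ act E u v pE) oW.
rewrite po in pW.
have nW : path_homotopic (map (place act) (o :: word_path x pth 1 r)) [:: x0].
  rewrite /= po; apply: scX; last by rewrite -{1}po last_map lW.
  by move: pW; rewrite /= po => /andP [].
have [_ /(_ pW) mv] := path_homotopic_triangle x0 nW.
have [E1 [c1 [P1 [[EE1 pE1] dE1 oP1 [mP1 lP1] h1]]]] :=
  lift_moves mv dE pE oW erefl.
(* The lifted list has one vertex because its image does, and that vertex is [o] because lifting
   keeps the endpoint. *)
have {}P1o : P1 = [:: o].
  case: P1 mP1 lP1 {oP1 h1} => [|z [|? ?]] //= _; rewrite lW => ->.
  by [].
rewrite P1o in h1.
have pE1' : letter_paths j0 pth E1.
  by move=> l; apply: (sub_path (span_sub EE1)) (pthE l).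
have [|E2 [c2 [EE2 pE2 dE2 R2]]] := IHR _ _ dE1 pE1 pE1'.
  by move=> r' r'R; apply: R1; rewrite inE r'R orbT.
exists E2, c2; split=> // [e /EE1 /EE2 //|r'].
rewrite inE => /predU1P [->|/R2 //].
apply: hom_sub (span_sub EE2) _.
apply: hom_trans (hom_trans h1 (hom_stutter _ _)).
exact/hom_sym/rst_step/(MoveStutter _ [::]).
Qed.

End Filling.

(** * Simple connectivity of the developed graph *)

Section Developed.
Variables (H : groupType) (J : choiceType) (j0 : J).
Local Notation U := (H * J)%type.
Variables (n : nat) (x : 'I_n -> H) (R : seq (word n)).
Hypothesis presR : is_presentation x R.
Variables (pth : 'I_n * bool -> seq U) (E : seq (U * U)) (c : J -> seq U).
Hypotheses (pth_ends : letter_ends j0 x pth) (pth_path : letter_paths j0 pth E).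
Hypothesis dE : developed j0 x pth E c.
Local Notation o h := (origin j0 h : U).
Local Notation wp := (word_path x pth).
Local Notation ev := (word_eval x).

(** Counted among the relators, so that one insertion argument serves both kinds of
    [relator_step]. *)
Definition free_cancellations : seq (word n) :=
  [seq [:: (l.1, l.2); (l.1, ~~ l.2)] | l <- enum {: 'I_n * bool}].

Lemma relators_eval1 : {in R ++ free_cancellations, forall r, ev r = 1}.
Proof.
move=> r; rewrite mem_cat => /orP [rR|/mapP [l _ ->]].
  rewrite -[1](word_eval_nil x); apply/presR.2/rst_step.
  by have := StepRelator [::] [::] rR; rewrite cats0.
by rewrite (word_eval_cat _ [:: _]) !word_eval1; case: l => i [] /=;
  rewrite ?mulVg ?mulgV.
Qed.

Hypothesis null_relators : {in R ++ free_cancellations, forall r,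
  homotopic (span E) (o 1 :: wp 1 r) [:: o 1]}.

Lemma null_relator h r : r \in R ++ free_cancellations ->
  homotopic (span E) (o h :: wp h r) [:: o h].
Proof.
move=> /null_relators /hom_origin => /(_ h).
by rewrite word_path_shift mulg1.
Qed.

Lemma word_path_insert h u r v : r \in R ++ free_cancellations ->
  homotopic (span E) (o h :: wp h (u ++ r ++ v)) (o h :: wp h (u ++ v)).
Proof.
move=> rR; rewrite !word_path_cat (relators_eval1 rR) mulg1.
apply: hom_catl; rewrite last_word_path //.
exact: (hom_catr (p' := [::])) (null_relator _ rR).
Qed.

Lemma word_path_hom h w1 w2 : ev w1 = ev w2 ->
  homotopic (span E) (o h :: wp h w1) (o h :: wp h w2).
Proof.
move/presR.2.
elim=> {w1 w2} [_ _ [u v i b|u v r rR] | w | w1 w2 _ | w1 w2 w3 _ + _].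
- apply: (@word_path_insert h u [:: (i, b); (i, ~~ b)] v).
  rewrite mem_cat; apply/orP; right; apply/mapP.
  by exists (i, b); rewrite ?mem_enum.
- by apply: word_path_insert; rewrite mem_cat rR.
- exact: hom_refl.
- exact: hom_sym.
- exact: hom_trans.
Qed.

(** The links of successive edges telescope: the tree path ending one link begins the next. *)
Lemma developed_path v p : v.2 \in dom j0 E -> path (span E) v p ->
  exists w, (last v p).1 = v.1 * ev w /\
  homotopic (span E) (o v.1 :: map (shift v.1) (c v.2) ++ p)
    (o v.1 :: wp v.1 w ++ map (shift (last v p).1) (c (last v p).2)).
Proof.
elim: p v => [|a p IHp] v vd /=.
  exists [::]; rewrite word_eval_nil mulg1 cats0; split=> //; exact: hom_refl.
case/andP=> va ap; have ad : a.2 \in dom j0 E by rewrite -(span_dom _ va).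
have [w1 [e1 h1]] := developed_linked dE vd va.
have [w2 [e2 h2]] := IHp _ ad ap.
exists (w1 ++ w2); split; first by rewrite e2 e1 word_eval_cat mulgA.
have := hom_catr p h1; rewrite -!catA; move/hom_trans; apply.
rewrite word_path_cat -catA; apply: hom_catl.
by rewrite last_word_path // -e1.
Qed.

(** Conjugated by the tree path of [v], the loop becomes the path of a word with value 1, which
    contracts; backtracking then removes the tree path. *)
Lemma developed_simply_connected v p : v.2 \in dom j0 E -> path (span E) v p ->
  last v p = v -> homotopic (span E) (v :: p) [:: v].
Proof.
move=> vd vp pv; have [w [ew]] := developed_path vd vp; rewrite pv.
have w1 : ev w = ev [::].
  by apply: (mulgI v.1); rewrite -ew pv word_eval_nil mulg1.
move=> hw; have {hw} := hom_trans hw (hom_catr _ (word_path_hom v.1 w1)).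
have [cp cl] := tree_path dE.1 vd; set cv := map _ _ in cp cl * => /= hv.
have hb := hom_backtrack_rev (@span_refl _ _ E) (@span_sym _ _ E) cp.
rewrite cl in hb; apply: hom_trans (hb).
apply: hom_trans (hom_sym (hom_catr p hb)) _.
rewrite -catA; apply: hom_catl.
by have := last_rev_belast (o v.1) cv; rewrite cl => ->.
Qed.

Lemma developed_connected u v : u.2 \in dom j0 E -> v.2 \in dom j0 E ->
  exists2 p, path (span E) u p & last u p = v.
Proof.
move=> ud vd; have [cp cl] := tree_path dE.1 ud; have [dp dl] := tree_path dE.1 vd.
have [w ew] := presR.1 (u.1^-1 * v.1).
have lu := last_rev_belast (o u.1) (map (shift u.1) (c u.2)).
rewrite cl in lu.
have lw : last (o u.1) (wp u.1 w) = o v.1 by rewrite last_word_path // ew mulVKg.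
(* Back along the tree path of [u], through the Cayley graph, and out along the tree path of [v]. *)
exists (rev (belast (o u.1) (map (shift u.1) (c u.2))) ++
        wp u.1 w ++ map (shift v.1) (c v.2)); last by rewrite !last_cat lu lw.
rewrite !cat_path lu lw dp word_path_path // !andbT -{1}cl path_rev //.
exact: span_sym.
Qed.

End Developed.

(** * Finiteness properties of the action *)

Section Finiteness.
Variables (G : groupType) (X : simplicial_complex) (a : simplicial_action G X).
Hypotheses (pa : proper_action a) (ca : cocompact_action a).

(** A nonempty transporter is a coset of the stabilizer of [y]. *)
Lemma finite_transporter (y z : X) : finite_set [set g | a g y = z].
Proof.
have [[g0 /= e0]|ne] := pselect (exists g, a g y = z); last first.
  by apply: (sub_finite_set (B := set0)) => // g /= e; case: ne; exists g.
have st := pa (simplex_vertex y).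
apply: (sub_finite_set
  (B := [set g0 * s | s in simplex_stabilizer a [fset y]]));
  last exact: finite_image.
move=> g /= e; exists (g0^-1 * g); last by rewrite mulVKg.
rewrite /simplex_stabilizer /=.
have e1 : a (g0^-1 * g) y = y by rewrite act_mul e -e0 -act_mul mulVg act_one.
apply/fsetP => w; rewrite inE; apply/imfsetP/eqP => [[t]|->].
  by rewrite inE => /eqP -> ->.
by exists y; rewrite ?inE.
Qed.

(** Finitely many orbits contain the simplices spanned by [y] and [a g z]. Within one orbit, some
    [k] carries a fixed simplex [s0] to that of [g]; since [k] sends a vertex of [s0] to [y] and
    another choice of vertex to [a g z], [finite_transporter] bounds first [k] and then [g]. *)
Lemma finite_adjacent (y z : X) : finite_set [set g | adj y (a g z)].
Proof.
apply: (sub_finite_set (B := \bigcup_(O in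
  [set simplex_orbit a s | s in [set s | s \in simplex X]])
  [set g | adj y (a g z) /\ simplex_orbit a [fset y; a g z] = O])).
  move=> g /= yg; exists (simplex_orbit a [fset y; a g z]) => //.
  by exists [fset y; a g z].
apply: bigcup_finite => // O _.
have [[g0 [_ eO]]|ne] := pselect (exists g, adj y (a g z) /\
    simplex_orbit a [fset y; a g z] = O); last first.
  by apply: (sub_finite_set (B := set0)) => // g /= e; case: ne; exists g.
set s0 := [fset y; a g0 z] in eO.
apply: (sub_finite_set (B :=
   \bigcup_(k in \bigcup_(w in [set` s0]) [set k | a k w = y])
   \bigcup_(w in [set` s0]) [set g | a g z = a k w])).
  move=> g /= [yg eg]; have : O [fset y; a g z].
    rewrite -eg; exists 1; apply/fsetP => w; apply/idP/imfsetP => [ws|[t ts ->]].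
      by exists w; rewrite ?act_one.
    by rewrite act_one.
  rewrite -eO => -[k ek].
  have : y \in [fset y; a g z] by rewrite !inE eqxx.
  rewrite ek => /imfsetP [w ws ew].
  have : a g z \in [fset y; a g z] by rewrite !inE eqxx orbT.
  rewrite ek => /imfsetP [w' ws' ew'].
  by exists k; [exists w|exists w'].
apply: bigcup_finite => [|k _]; apply: bigcup_finite; try exact: finite_fset;
  by move=> w _; apply: finite_transporter.
Qed.

End Finiteness.

(** * Assembly of the construction and restriction to a subgroup *)

Section FinitelyPresented.
Variables (H : groupType) (X : simplicial_complex) (a : simplicial_action H X).
Hypothesis sX : systolic X.
Hypothesis finA : forall y z : X, finite_set [set h | adj y (a h z)].

Theorem finitely_presented_systolic : finitely_presented H -> systolic_group H.
Proof.
case=> n [x [R presR]]; case: sX => _ scX lX _.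
have [[x0 _] cX _] := scX.
have [pth [E0 [c0 [pe pp0 dE0 pE0]]]] := letters_exist a x0 x cX.
have [E [c [EE pE dE nullR]]] :=
  fill_relators pe scX dE0 pE0 pp0 (relators_eval1 presR).
have pp : letter_paths (x0, 0%N) pth E.
  by move=> l; apply: (sub_path (span_sub EE)) (pp0 l).
(* The labels in use become the finite type [I]; [i0] is the value of [down] off [D]. *)
pose D := dom ((x0, 0%N) : X * nat) E.
have iP : (x0, 0%N) \in D by exact: dom0.
pose i0 : seq_sub D := SeqSub iP.
pose V := (H * seq_sub D)%type.
pose up (v : V) : H * (X * nat) := (v.1, val v.2).
pose down (u : H * (X * nat)) : V := (u.1, insubd i0 u.2).
have upK : cancel up down by move=> [h i]; rewrite /down /up /= valKd.
have downK u : u.2 \in D -> up (down u) = u.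
  by move=> ud; rewrite /up /down /= insubdK //; case: u ud.
have upD v : (up v).2 \in D by exact: valP.
pose RV : rel V := fun u v => span E (up u) (up v).
(* The pullback of the 1-skeleton of [X]; vertices with the same image are related too. *)
pose Q0 : rel V := fun u v => adj (place a (up u)) (place a (up v)).
have downR u v : span E u v -> RV (down u) (down v).
  apply: (span_min (e := fun u v => RV (down u) (down v))).
  - by move=> w; apply: span_refl.
  - by move=> w t; apply: span_sym.
  - by move=> g w t; apply: span_inv.
  - move=> w t wt; rewrite /RV !downK; first exact: span_gen.
      by apply/domP; right; exists (w, t) => //=; auto.
    by apply/domP; right; exists (w, t) => //=; auto.
have RVs : symmetric RV by move=> u v; apply: span_sym.
have RVi : invariant_rel RV by move=> g u v; apply: span_inv.
have RVup u p : path RV u p -> path (span E) (up u) (map up p).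
  by apply: path_map_sub.
have RVsc : simply_connected_rel RV.
  move=> v p vp pv.
  have := @developed_simply_connected _ _ _ _ _ _ presR _ _ _ pe dE nullR (up v)
    (map up p) (upD v) (RVup _ _ vp).
  rewrite last_map pv => /(_ erefl) /(hom_map downR).
  by rewrite /= -map_comp (eq_map (g := id)) ?map_id ?upK.
have RVc u v : exists2 p, path RV u p & last u p = v.
  have [p up_p pv] := developed_connected presR pe pp dE (upD u) (upD v).
  exists (map down p); last by rewrite -{1}[u]upK last_map pv upK.
  by rewrite -{1}[u]upK; apply: path_map_sub up_p.
have Q0r : reflexive Q0 by move=> u; apply: adj_refl.
have Q0s : symmetric Q0 by move=> u v; apply: adj_sym.
have Q0i : invariant_rel Q0.
  by move=> g u v uv; rewrite /Q0 !(place_shift a g (up _)); apply: adj_act.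
have Q0l : large_rel Q0.
  have [L4 L5] := adj_large lX.
  by split=> *; [apply: L4 | apply: L5].
have RQ0 : subrel RV Q0 by move=> u v; apply: span_adj.
have /finite_seqP [N eN] : finite_set [set v | exists i, Q0 (1, i) v].
  (* A neighbour [(h, j)] of [(1, i)] is given by [j] and [h], and [finA] leaves finitely many [h]
     for each pair of labels. *)
  apply: (sub_finite_set (B := \bigcup_(ij in [set: seq_sub D * seq_sub D])
    [set (h, ij.2) | h in
      [set h | adj (place a (up (1, ij.1))) (a h (val ij.2).1)]])).
    by move=> [h j] /= [i ij]; exists (i, j) => //; exists h.
  apply: bigcup_finite => [|[i j] _]; first exact: finite_finset.
  exact/finite_image/finA.
have Q0N i v : Q0 (1, i) v -> v \in N.
  move=> iv; have : [set v | exists i, Q0 (1, i) v] v by exists i.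
  by rewrite eN.
have [Q [[Qr Qs Qi] Ql Qsc QQ0 RQ]] :=
  exists_simply_connected_large RVs RVi RVsc Q0r Q0s Q0i Q0l Q0N RQ0.
apply: (systolic_group_of_rel Qr Qs Qi (N := N) (1, i0)) => //.
- by move=> i v /QQ0 /Q0N.
- move=> u v; have [p up_p pv] := RVc u v; exists p => //.
  exact: (sub_path RQ) up_p.
Qed.

End FinitelyPresented.

Section Restriction.
Variables (G : groupType) (S : pred G) (H : subGroupType S).
Variables (X : simplicial_complex) (a : simplicial_action G X).

Definition restricted_action : simplicial_action H X.
Proof.
refine (@SimplicialAction H X (fun h => a (val h)) _ _ _).
- by move=> y; rewrite val1 act_one.
- by move=> g h y; rewrite valM act_mul.
- by move=> g s; apply: act_simplex.
Defined.

End Restriction.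

Theorem theorem2 (G : groupType) (S : pred G) (H : subGroupType S) :
  systolic_group G -> finitely_presented H -> systolic_group H.
Proof.
case=> X [sX [a [pa ca]]].
apply: (finitely_presented_systolic (a := restricted_action H a) sX) => y z.
(* Unlike cocompactness, this finiteness passes from [G] to the subgroup, the inclusion being
   injective. *)
apply: (finite_preimage (f := val : H -> G) (B := [set g | adj y (a g z)])).
  by move=> g h _ _; apply: val_inj.
exact: finite_adjacent.
Qed.
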